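(* Let $q>2$ be a prime power, $n$ a positive integer and $F=\mathbb{F}_{q^{2n+1}}$. Let $\alpha=-1$ if $q$ is odd and let $\alpha$ be any element of $\mathbb{F}_q\setminus\{0,1\}$ if $q$ is even. Consider the projective space $\mathrm{PG}(4n+1,q)$ whose points are the $1$-dimensional $\mathbb{F}_q$-subspaces of the $\mathbb{F}_q$-vector space $F\times F$; write $P(a,b)$ for the point spanned by $(a,b)\ne(0,0)$. For $\omega\in F^*$ let $\mathcal{V}_\omega=\{P(x^2,\omega x^{q+1}):x\in F^*\}$. Then $\mathcal{V}_1\cup\mathcal{V}_\alpha$ is a complete cap of $\mathrm{PG}(4n+1,q)$ of size $2(q^{2n+1}-1)/(q-1)$.
   Context: A cap is a set of points no three of which are collinear; it is complete if it is not contained in a strictly larger cap. *)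

(* Defs.v *)
From HB Require Import structures.
From mathcomp Require Import all_boot all_order all_algebra all_field.
From mathcomp Require Import classical_sets cardinality.

Set Implicit Arguments.
Unset Strict Implicit.
Unset Printing Implicit Defensive.

Import GRing.Theory.
Local Open Scope classical_set_scope.
Local Open Scope ring_scope.

Section ProjectiveSpace.
Variables (K : fieldType) (V : vectType K).

Definition is_point (U : {vspace V}) : Prop := \dim U = 1%N.

Definition is_line (U : {vspace V}) : Prop := \dim U = 2%N.

Definition collinear (U1 U2 U3 : {vspace V}) : Prop :=
  exists2 l : {vspace V}, is_line l &
    [/\ (U1 <= l)%VS, (U2 <= l)%VS & (U3 <= l)%VS].

(* The three points must be pairwise distinct: two points, or one, always lie
   on a common line (as soon as there is a line at all). *)
Definition is_cap (S : set {vspace V}) : Prop :=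
  S `<=` [set U | is_point U] /\
  forall U1 U2 U3, S U1 -> S U2 -> S U3 ->
    U1 <> U2 -> U1 <> U3 -> U2 <> U3 -> ~ collinear U1 U2 U3.

Definition is_complete_cap (S : set {vspace V}) : Prop :=
  is_cap S /\ ~ exists2 T, is_cap T & S `<` T.

End ProjectiveSpace.

Section Veronese.
Variables (K : finFieldType) (F : fieldExtType K).

Definition P (a b : F) : {vspace (F * F)%type} := <[(a, b)]>%VS.

Definition Vset (omega : F) : set {vspace (F * F)%type} :=
  [set P (x ^+ 2) (omega * x ^+ (#|K| + 1)) | x in [set x : F | x != 0]].

End Veronese.

(* Main.v *)
(** Put N = (q^(2n+1) - 1)/(q - 1), which has the form 1 + q(q+1)M; in
    particular N is odd, and every x in F* is a norm times a (q+1)-th power.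

    Cap: a relation a x^2 + b y^2 = z^2, a x^(q+1) + b y^(q+1) = beta z^(q+1)
    with a, b in F_q, together with the q-th power of its first equation, says
    that a Gram determinant a b (x y^q - y x^q)^2 equals
    (1 - beta^2) z^(2q+2).  For beta^2 = 1 this forces P(x) = P(y).  For q even,
    taking square roots gives t^q + t = 1 + beta with t in F, and the trace gives
    beta = 1.

    Completeness: every (A, B) lies on a secant joining V_1 to V_alpha.  For q
    even this reduces to the bijectivity of z |-> z^(q+1).  For q odd we may take
    A = 1; let w + 1/w = 2B in an algebraic closure.  If w is in F, write
    w = a z^(q+1) and use x, y = (z +- 1/(a z))/2.  Otherwise
    w^(q^(2n+1)) = 1/w; with z^(q-1) = 1/w, z' = z^(q^(2n+1)) and i^(q-1) = -1,
    the elements z + z' and (z - z')/i of F do the job. *)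
Require Import Defs.
From HB Require Import structures.
From mathcomp Require Import all_boot all_order all_algebra all_field.
From mathcomp Require Import pgroup cyclic.
From mathcomp Require Import boolp classical_sets cardinality.
From mathcomp Require Import ring zify.

Set Implicit Arguments.
Unset Strict Implicit.
Unset Printing Implicit Defensive.

Import GRing.Theory.
Local Open Scope classical_set_scope.
Local Open Scope card_scope.
Local Open Scope ring_scope.

(** * Arithmetic of the point count, and finite fields inside larger rings *)

Lemma expn_odd_decomp (q n : nat) : (0 < q)%N ->
  exists M, (q ^ (2 * n + 1) = (q - 1) * (1 + q * (q + 1) * M) + 1)%N.
Proof.
move=> q0; elim: n => [|n [M IH]]; first by exists 0%N; rewrite muln0 expn1; lia.
(* The cofactor of q - 1 is 1 + q + ... + q^(2n); passing to n + 1 adds q^(2n+1) + q^(2n+2) = q (q +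
   1) q^(2n). *)
exists (M + q ^ (2 * n))%N; rewrite mulnS -addnA expnD; move: IH.
rewrite addn1 !expnS expn0 muln1; move: (q ^ (2 * n))%N => u.
by case: q q0 => // q _; rewrite subn1 /=; nia.
Qed.

Lemma exprD_card (K : finFieldType) (R : comNzRingType) (f : {rmorphism K -> R})
  (x y : R) : (x + y) ^+ #|K| = x ^+ #|K| + y ^+ #|K|.
Proof.
have [p p_pr pK] := finPcharP K.
have pR : p \in [pchar R] by apply: (rmorph_pchar f).
apply: exprDn_pchar; have := pprimeChar_pgroup pK; rewrite /pgroup cardsT.
by apply: sub_in_pnat => r _ /eqnP->.
Qed.

(** X^|L| - X already splits over L, with the elements of L as its roots. *)
Lemma expf_card_rmorph (L : finFieldType) (E : fieldType) (f : {rmorphism L -> E})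
  (x : E) : x ^+ #|L| = x -> exists y, x = f y.
Proof.
move=> xL; have : root (map_poly f ('X^#|L| - 'X)) x.
  by rewrite rmorphB /= map_polyXn map_polyX rootE !hornerE xL subrr.
rewrite finField_genPoly rmorph_prod rootE horner_prod prodf_seq_eq0.
by case/hasP=> y _ /=; rewrite map_polyXsubC !hornerE subr_eq0 => /eqP->; exists y.
Qed.

Lemma closed_root_exp (E : closedFieldType) (k : nat) (w : E) : (0 < k)%N ->
  exists z, z ^+ k = w.
Proof.
move=> k0; have [|z] := @closed_rootP E ('X^k - w%:P) _.
  by rewrite size_XnsubC // eqSS -lt0n.
by rewrite rootE !hornerE subr_eq0 => /eqP <-; exists z.
Qed.

Lemma closed_root_quad (E : closedFieldType) (b c : E) :
  exists w, w ^+ 2 + b * w + c = 0.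
Proof.
have [w] := solve_monicpoly (fun i => if i == 0%N then - c else - b) (isT : 0 < 2)%N.
rewrite !big_ord_recl big_ord0 /= => wE; exists w; rewrite wE expr0 expr1; ring.
Qed.

Lemma card_finFieldX (K : finFieldType) :
  exists p k, [/\ p \in [pchar K], (0 < k)%N & #|K| = (p ^ k)%N].
Proof.
have [p p_pr pK] := finPcharP K.
have := pprimeChar_pgroup pK; rewrite /pgroup cardsT.
case/p_natP=> // k Kk; exists p, k; split=> //.
by case: k Kk => // K1; have := finNzRing_gt1 K; rewrite [#|_|]K1.
Qed.

Lemma odd_card_finField (K : finFieldType) : odd #|K| = (2%:R != 0 :> K).
Proof.
have [p [k [pK k0 ->]]] := card_finFieldX K; rewrite oddX eqn0Ngt k0 /=.
have p_pr := pcharf_prime pK; rewrite -(dvdn_pcharf pK) dvdn_prime2 //.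
case: (even_prime p_pr) => [->//|po].
by rewrite po; apply/esym; apply: contraTneq po => ->.
Qed.

(** * Frobenius and power decompositions in an extension of odd degree *)

Section OddDegree.

Variables (K : finFieldType) (F : fieldExtType K) (n : nat).
Hypothesis dimF : \dim {:F} = (2 * n + 1)%N.
Let q := #|K|.

Lemma card_gt0 : (0 < q)%N.
Proof. exact: ltnW (finNzRing_gt1 K). Qed.

Lemma frobD (x y : F) : (x + y) ^+ q = x ^+ q + y ^+ q.
Proof. exact: (@exprD_card K F (in_alg F : {rmorphism K -> F})). Qed.

Lemma frobN (x : F) : (- x) ^+ q = - x ^+ q.
Proof.
apply/eqP; rewrite -addr_eq0 addrC -frobD subrr expr0n.
by rewrite eqn0Ngt card_gt0.
Qed.

Lemma frobB (x y : F) : (x - y) ^+ q = x ^+ q - y ^+ q.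
Proof. by rewrite frobD frobN. Qed.

Lemma alg_fixed (k : K) : (k%:A : F) ^+ q = k%:A.
Proof. by rewrite -[_%:A]/(in_alg F k) -rmorphXn expf_card. Qed.

Lemma fixed_alg (x : F) : x ^+ q = x -> exists k : K, x = k%:A.
Proof.
move=> xq; apply/vlineP.
by have := Fermat's_little_theorem 1%AS x; rewrite dimv1 expn1 xq eqxx.
Qed.

Lemma expf_card_ext (x : F) : x ^+ (q ^ (2 * n + 1)) = x.
Proof.
by apply/eqP; have := Fermat's_little_theorem {:F}%AS x; rewrite memvf dimF.
Qed.

Lemma fixedP (t : F) : t != 0 -> (t ^+ q == t) = (t ^+ (q - 1) == 1).
Proof.
by move=> t0; rewrite -[q in LHS](subnK card_gt0) addn1 exprSr
   -{3}[t]mul1r (inj_eq (mulIf t0)).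
Qed.

(* The witness is a = N(x) = x ^ (1 + q (q + 1) M), the norm of x to K. *)
Lemma norm_decomp (x : F) : x != 0 ->
  exists a s, [/\ a ^+ q = a, a != 0, s != 0 & x = a * s ^+ (q * (q + 1))].
Proof.
move=> x0; have [M QE] := @expn_odd_decomp q n card_gt0.
exists (x ^+ (1 + q * (q + 1) * M)), (x^-1 ^+ M); split.
- apply/eqP; rewrite fixedP ?expf_neq0 //; apply/eqP/(mulIf x0).
  by rewrite mul1r -exprM -exprSr -addn1 -[RHS]expf_card_ext QE (mulnC (q - 1)%N).
- exact: expf_neq0.
- by rewrite expf_neq0 ?invr_eq0.
- rewrite -exprM exprD expr1 -mulrA exprVn [X in _ * (_ * (x ^+ X)^-1)]mulnC.
  by rewrite divff ?mulr1 // expf_neq0.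
Qed.

Lemma expq1_decomp (x : F) : x != 0 ->
  exists a s, [/\ a ^+ q = a, a != 0, s != 0 & x = a * s ^+ (q + 1)].
Proof.
case/norm_decomp=> a [s [aq a0 s0 ->]]; exists a, (s ^+ q).
by rewrite expf_neq0 // -exprM.
Qed.

Lemma sqr_decomp (x : F) : x != 0 ->
  exists a s, [/\ a ^+ q = a, a != 0, s != 0 & x = a * s ^+ 2].
Proof.
case/norm_decomp=> a [s [aq a0 s0 ->]]; exists a, (s ^+ (q * (q + 1))./2).
rewrite expf_neq0 // -exprM muln2 halfK; suff -> : odd (q * (q + 1)) = false by rewrite subn0.
by rewrite oddM oddD /=; case: odd.
Qed.

(** The order of [t ^+ (q - 1)] divides both 2 and the odd number 1 + q (q + 1) M. *)
Lemma expf_root_odd (t : F) : t != 0 -> (t ^+ (q - 1)) ^+ 2 = 1 -> t ^+ (q - 1) = 1.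
Proof.
move=> t0 t2; have [M QE] := @expn_odd_decomp q n card_gt0.
have := expf_card_ext t; rewrite QE exprD expr1 -[RHS]mul1r => /(mulIf t0).
rewrite exprM exprD expr1; suff -> : (t ^+ (q - 1)) ^+ (q * (q + 1) * M) = 1 by rewrite mulr1.
rewrite -(odd_double_half (q * (q + 1) * M)) -muln2 mulnC -[in X in _ ^+ X]mulnC.
have -> : odd (q * (q + 1) * M) = false by rewrite !oddM oddD /=; case: (odd q).
by rewrite add0n mulnC exprM t2 expr1n.
Qed.

(** If t^2 lies in K then t^(q-1) squares to 1, and the odd degree forces it to be 1. *)
Lemma sqr_fixed (t : F) : (t ^+ 2) ^+ q = t ^+ 2 -> t ^+ q = t.
Proof.
have [-> _|t0 t2] := eqVneq t 0; first by rewrite expr0n eqn0Ngt card_gt0.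
apply/eqP; rewrite fixedP //; apply/eqP/expf_root_odd => //.
by rewrite -exprM mulnC exprM; apply/eqP; rewrite -fixedP ?expf_neq0 // t2.
Qed.

Lemma sqrt_fixed (a : F) : ~~ odd q -> a ^+ q = a -> exists2 c, c ^+ q = c & a = c ^+ 2.
Proof.
move=> q_even aq; exists (a ^+ q./2); first by rewrite -exprM mulnC exprM aq.
by rewrite -exprM muln2 halfK (negPf q_even) subn0.
Qed.


(** * Algebraic relations behind the cap property *)

Lemma expq1 (x : F) : x ^+ (q + 1) = x * x ^+ q.
Proof. by rewrite addn1 exprS. Qed.

(** Serves three points of one set V (beta = 1) in every characteristic, and mixed triples for q odd
    (beta = -1). *)
Lemma mixed_relation_odd (a b beta x y z : F) :
    a ^+ q = a -> b ^+ q = b -> a != 0 -> b != 0 -> beta ^+ 2 = 1 ->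
    a * x ^+ 2 + b * y ^+ 2 = z ^+ 2 ->
    a * x ^+ (q + 1) + b * y ^+ (q + 1) = beta * z ^+ (q + 1) ->
  x * y ^+ q = y * x ^+ q.
Proof.
move=> aq bq a0 b0 beta2 E1 E2.
have E3 : a * (x ^+ q) ^+ 2 + b * (y ^+ q) ^+ 2 = (z ^+ q) ^+ 2.
  by rewrite -!(exprAC _ 2) -E1 frobD !exprMn aq bq.
have : a * b * (x * y ^+ q - y * x ^+ q) ^+ 2 = 0.
  move: E2 E3; rewrite !expq1; move: (x ^+ q) (y ^+ q) (z ^+ q) => X Y Z E2 E3.
  (* Lagrange's identity for the diagonal form with coefficients a, b at the vectors (x, y) and (X,
     Y) = (x^q, y^q). *)
  transitivity ((a * x ^+ 2 + b * y ^+ 2) * (a * X ^+ 2 + b * Y ^+ 2)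
                - (a * (x * X) + b * (y * Y)) ^+ 2); first by ring.
  by rewrite E1 E2 E3 exprMn beta2; ring.
by move/eqP; rewrite !mulf_eq0 (negPf a0) (negPf b0) /= orbb subr_eq0 => /eqP.
Qed.

Lemma char2_natr : ~~ odd q -> 2%:R = 0 :> F.
Proof.
rewrite odd_card_finField negbK => /eqP K2.
by rewrite -(rmorph_nat (in_alg F)) K2 rmorph0.
Qed.

(* Summing t ^ q - t = c over the 2n+1 conjugates of t gives c = 0. *)
Lemma trace_zero (t c : F) : ~~ odd q -> c ^+ q = c -> t ^+ q = t + c -> c = 0.
Proof.
move=> q_even cq tq; have c2 : c + c = 0.
  by rewrite -mulr2n -mulr_natr char2_natr ?mulr0.
have tqk k : t ^+ (q ^ k) = t + c *+ k.
  elim: k => [|k IH]; first by rewrite expr1 addr0.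
  rewrite expnSr exprM IH frobD tq -addrA mulrS; congr (_ + (_ + _)).
  by elim: k {IH} => [|k IH]; rewrite ?mulr0n ?expr0n ?eqn0Ngt ?card_gt0 // !mulrS frobD IH cq.
have := expf_card_ext t; rewrite tqk -[RHS]addr0 => /addrI.
by rewrite mulrnDr mulrnA mulr2n c2 mul0rn add0r mulr1n.
Qed.

Lemma mixed_relation_even (a b beta x y z : F) : ~~ odd q ->
    a ^+ q = a -> b ^+ q = b -> beta ^+ q = beta -> z != 0 ->
    a * x ^+ 2 + b * y ^+ 2 = z ^+ 2 ->
    a * x ^+ (q + 1) + b * y ^+ (q + 1) = beta * z ^+ (q + 1) ->
  beta = 1.
Proof.
move=> q_even aq bq betaq z0 E1 E2; have F2 := char2_natr q_even.
have [c cq aE] := sqrt_fixed q_even aq; have [d dq bE] := sqrt_fixed q_even bq.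
(* In characteristic 2 the first relation is the square of c x + d y = z. *)
have /eqP : (c * x + d * y - z) ^+ 2 = 0.
  transitivity (a * x ^+ 2 + b * y ^+ 2 - z ^+ 2
      + 2%:R * (c * x * (d * y) - (c * x + d * y) * z + z ^+ 2)).
    by rewrite aE bE; ring.
  by rewrite E1 F2; ring.
rewrite sqrf_eq0 subr_eq0 => /eqP zE.
(* Dividing by z leaves one unknown: c x = z t and d y = z (1 - t), so the second relation becomes
   beta = t t^q + (1 - t)(1 - t^q), which is 1 + t + t^q in characteristic 2. *)
pose t := c * x / z; have xE : c * x = z * t by rewrite /t [z * _]mulrC divfK.
have yE : d * y = z * (1 - t) by rewrite mulrBr mulr1 -xE -zE addrAC subrr add0r.
have cyE : c * x ^+ q = z ^+ q * t ^+ q by rewrite -[in LHS]cq -exprMn xE exprMn.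
have dyE : d * y ^+ q = z ^+ q * (1 - t ^+ q).
  by rewrite -[in LHS]dq -exprMn yE exprMn frobB expr1n.
have betaE : beta = t * t ^+ q + (1 - t) * (1 - t ^+ q).
  have zq0 : z * z ^+ q != 0 by rewrite mulf_neq0 ?expf_neq0.
  apply: (mulfI zq0); rewrite [LHS]mulrC -expq1 -E2 aE bE !expq1.
  transitivity ((c * x) * (c * x ^+ q) + (d * y) * (d * y ^+ q)); first by ring.
  by rewrite xE yE cyE dyE; ring.
have tE : t ^+ q = t + (1 - beta).
  apply/eqP; rewrite -subr_eq0 betaE; apply/eqP.
  by transitivity (2%:R * (t * (t ^+ q - 1))); [ring | rewrite F2 mul0r].
apply/esym/eqP; rewrite -subr_eq0; apply/eqP/(trace_zero q_even _ tE).
by rewrite frobB expr1n betaq.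
Qed.

(** * Secants between V_1 and V_alpha through an arbitrary vector *)

Lemma mixed_secant_even (alpha A B : F) : ~~ odd q ->
    alpha ^+ q = alpha -> alpha != 1 ->
  exists a b x y, [/\ a ^+ q = a, b ^+ q = b,
    A = a * x ^+ 2 + b * y ^+ 2 &
    B = a * x ^+ (q + 1) + b * (alpha * y ^+ (q + 1))].
Proof.
move=> q_even alq al1; have F2 := char2_natr q_even.
have al0 : 1 + alpha != 0.
  rewrite (_ : 1 + alpha = 2%:R * 1 + (alpha - 1)); last by ring.
  by rewrite F2 mul0r add0r subr_eq0.
have [s AE] : exists s, A = s ^+ 2.
  have [->|A0] := eqVneq A 0; first by exists 0; rewrite expr0n.
  have [a [s [aq _ _ ->]]] := sqr_decomp A0.
  by have [c _ ->] := sqrt_fixed q_even aq; exists (c * s); rewrite exprMn.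
have [z zE] : exists z, z ^+ (q + 1) =
    (B - alpha / (1 + alpha) * s ^+ (q + 1)) / (1 + alpha).
  move: (_ / (1 + alpha)) => w.
  have [->|w0] := eqVneq w 0; first by exists 0; rewrite expr0n addn1.
  have [a [u [aq _ _ ->]]] := expq1_decomp w0.
  (* For c in K one has c^(q+1) = c^2, so c^2 u^(q+1) is a (q+1)-th power. *)
  have [c cq ->] := sqrt_fixed q_even aq; exists (c * u).
  by rewrite exprMn (expq1 c) cq -expr2.
pose beta := alpha / (1 + alpha).
have betaq : beta ^+ q = beta by rewrite /beta exprMn exprVn frobD expr1n alq.
(* With a = b = 1 the first equation reads x + y = s; the shift x = z + beta s removes the mixed
   terms z s^q and s z^q from x^(q+1) + alpha y^(q+1). *)
exists 1, 1, (z + beta * s), (s - (z + beta * s)).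
rewrite expr1n; split=> //.
  rewrite AE; apply/eqP; rewrite -subr_eq0; apply/eqP.
  transitivity (2%:R * ((z + beta * s) * (s - (z + beta * s)))); first by ring.
  by rewrite F2 mul0r.
move: zE; rewrite !expq1 frobB frobD exprMn betaq.
move: (z ^+ q) (s ^+ q) => Z S zE.
have -> : B = (1 + alpha) * (z * Z) + alpha / (1 + alpha) * (s * S).
  by rewrite zE; field.
by rewrite /beta; field.
Qed.

Lemma card_ext : #|(FinFieldExtType F : finFieldType)| = (q ^ (2 * n + 1))%N.
Proof.
rewrite -dimF -(@card_vspace K (FinFieldExtType F) (Vector.class F)).
by apply: eq_card => x; rewrite memvf.
Qed.

(** Supplies a field containing the roots of w^2 - 2 B w + 1, in which membership in F is tested by
    the Q-power map. *)
Lemma closure_ext (Q := (q ^ (2 * n + 1))%N) :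
  exists (E : closedFieldType) (f : {rmorphism F -> E}),
    (forall x y : E, (x + y) ^+ Q = x ^+ Q + y ^+ Q) /\
    (forall x : E, x ^+ Q = x -> exists y, x = f y).
Proof.
pose L : finFieldType := FinFieldExtType F.
have LQ : #|L| = Q := card_ext.
have [E [f _]] := countable_algebraic_closure L.
exists E, (f : {rmorphism F -> E}); split=> [x y|x xQ].
  by rewrite -LQ; exact: (@exprD_card L E f x y).
by apply: (@expf_card_rmorph L E f); rewrite LQ.
Qed.

Lemma mixed_secant_unit_split (B w : F) : odd q -> w ^+ 2 - 2%:R * B * w + 1 = 0 ->
  exists a b x y, [/\ a ^+ q = a, b ^+ q = b,
    a * x ^+ 2 + b * y ^+ 2 = 1 &
    B = a * x ^+ (q + 1) - b * y ^+ (q + 1)].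
Proof.
rewrite odd_card_finField -(fmorph_eq0 (in_alg F)) rmorph_nat => F2 wE.
have w0 : w != 0.
  by apply/eqP=> w0; move: wE; rewrite w0 expr0n mulr0 subr0 add0r => /eqP; rewrite oner_eq0.
have [a [z [aq a0 z0 waz]]] := expq1_decomp w0.
have two_q : (2%:R : F) ^+ q = 2%:R.
  by rewrite -(rmorph_nat (in_alg F)) /= alg_fixed.
(* Since x + y = z and x - y = 1/(a z), a (x^2 - y^2) = 1; moreover a (x^(q+1) + y^(q+1)) = (w +
   1/w)/2. *)
exists a, (- a), ((z + (a * z)^-1) / 2%:R), ((z - (a * z)^-1) / 2%:R).
rewrite frobN aq; split=> //; first by field; rewrite F2 z0 a0.
rewrite !expq1 !exprMn !exprVn frobB frobD !exprVn exprMn two_q aq.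
have zq0 : z ^+ q != 0 by rewrite expf_neq0.
apply: (mulIf w0); apply: (mulIf F2); apply/eqP; rewrite -subr_eq0; apply/eqP.
transitivity (- (w ^+ 2 - 2%:R * B * w + 1)); last by rewrite wE oppr0.
move: waz zq0; rewrite expq1; move: (z ^+ q) => Z -> Z0.
by field; rewrite F2 a0 z0 Z0.
Qed.

Lemma mixed_secant_unit_nonsplit (B : F) (E : closedFieldType)
    (f : {rmorphism F -> E}) (Q := (q ^ (2 * n + 1))%N) (w : E) : odd q ->
    (forall x y : E, (x + y) ^+ Q = x ^+ Q + y ^+ Q) ->
    (forall x : E, x ^+ Q = x -> exists y, x = f y) ->
    w ^+ 2 - 2%:R * f B * w + 1 = 0 -> w ^+ Q = w^-1 ->
  exists a b x y, [/\ a ^+ q = a, b ^+ q = b,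
    a * x ^+ 2 + b * y ^+ 2 = 1 &
    B = a * x ^+ (q + 1) - b * y ^+ (q + 1)].
Proof.
move=> q_odd ED EQ wE wQ.
have F2 : 2%:R != 0 :> F.
  by move: q_odd; rewrite odd_card_finField -(fmorph_eq0 (in_alg F)) rmorph_nat.
have E2 : 2%:R != 0 :> E by rewrite -(rmorph_nat f) fmorph_eq0.
have E4 : 4%:R != 0 :> E by rewrite (natrM _ 2 2) mulf_neq0.
have w0 : w != 0.
  by apply/eqP=> w0; move: wE; rewrite w0 expr0n mulr0 subr0 add0r => /eqP; rewrite oner_eq0.
have q1 : (0 < q - 1)%N by rewrite subn_gt0 finNzRing_gt1.
have qE : q = (q - 1).+1 by rewrite subn1 prednK ?card_gt0.
have Q_odd : odd Q by rewrite oddX q_odd orbT.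
have EN (x : E) : (- x) ^+ Q = - x ^+ Q by rewrite exprNn -signr_odd Q_odd mulN1r.
have ENq (x : E) : (- x) ^+ q = - x ^+ q by rewrite exprNn -signr_odd q_odd mulN1r.
have EDq (x y : E) : (x + y) ^+ q = x ^+ q + y ^+ q.
  exact: (@exprD_card K E (f \o in_alg F : {rmorphism K -> E})).
have EKq (x : E) : x ^+ q = x -> exists2 k : F, k ^+ q = k & x = f k.
  move=> /(@expf_card_rmorph K E (f \o in_alg F : {rmorphism K -> E}))[k ->].
  by exists k%:A => //; apply: alg_fixed.
have [z zw] := closed_root_exp w^-1 q1; have [i iN] := closed_root_exp (-1 : E) q1.
have z0 : z != 0.
  by apply: contra_eq_neq zw => ->; rewrite expr0n eqn0Ngt q1 eq_sym invr_eq0.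
have i0 : i != 0.
  by apply: contra_eq_neq iN => ->; rewrite expr0n eqn0Ngt q1 eq_sym oppr_eq0 oner_eq0.
have zq : z ^+ q = z / w by rewrite qE exprS zw.
have iq : i ^+ q = - i by rewrite qE exprS iN mulrN1.
(* Each of the 2n + 1 successive q-th powers negates i, and their number is odd. *)
have iQ : i ^+ Q = - i.
  have iqk k : i ^+ (q ^ k) = (-1) ^+ k * i.
    elim: k => [|k IH]; first by rewrite expr1 mul1r.
    by rewrite expnSr exprM IH exprMn iq exprS exprAC ENq expr1n mulrN mulN1r mulNr.
  by rewrite iqk -signr_odd oddD oddM mulN1r.
pose z1 := z ^+ Q; pose c := z * z1.
have z10 : z1 != 0 by rewrite expf_neq0.
have c0 : c != 0 by rewrite mulf_neq0.
have z1q : z1 ^+ q = z1 * w.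
  by rewrite /z1 -exprM mulnC exprM zq exprMn exprVn wQ invrK.
(* The q-th power divides z by w and multiplies z1 by w, so their product c lies in K. *)
have cq : c ^+ q = c by rewrite /c exprMn zq z1q; field.
(* The Q-power map exchanges z and z1 and negates i, hence fixes both z + z1 and (z - z1)/i. *)
have z1Q : z1 ^+ Q = z.
  have -> : z1 = c / z by rewrite /c mulrC mulKf.
  have cQ k : c ^+ (q ^ k) = c by elim: k => // k IH; rewrite expnS exprM cq.
  by rewrite exprMn exprVn cQ -/z1 mulfK.
have [x xE] : exists x, z + z1 = f x by apply: EQ; rewrite ED z1Q addrC.
have [y yE] : exists y, (z - z1) / i = f y.
  apply: EQ; rewrite exprMn exprVn ED EN z1Q iQ -/z1; field.
  by rewrite oppr_eq0 i0.
have [k kq cE] := EKq _ cq.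
have [d dq dE] : exists2 d, d ^+ q = d & i ^+ 2 = f d.
  by apply: EKq; rewrite -exprM mulnC exprM iq sqrrN.
have k0 : k != 0 by rewrite -(fmorph_eq0 f) -cE.
have four_q : (4%:R : F) ^+ q = 4%:R.
  by rewrite -(rmorph_nat (in_alg F)) /= alg_fixed.
(* Under f, k is z z1 and d is i^2, so the first equation is (z + z1)^2 - (z - z1)^2 = 4 z z1. In
   the second, i^(q+1) = -i^2 turns the sum into 2 z z1 (w + 1/w) over 4 z z1. *)
exists (4%:R * k)^-1, (- d / (4%:R * k)), x, y; split.
- by rewrite exprVn exprMn four_q kq.
- by rewrite exprMn exprVn frobN exprMn four_q kq dq.
- apply: (@fmorph_inj _ _ f); rewrite !(rmorph1, rmorphD, rmorphN, rmorphM) /=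
    !(rmorphXn, fmorphV, rmorphM, rmorph_nat) /=.
  rewrite -xE -yE -dE -cE /c; field.
  by rewrite z0 z10 i0 E4.
apply: (@fmorph_inj _ _ f); rewrite !(rmorph1, rmorphD, rmorphN, rmorphM) /=
    !(rmorphXn, fmorphV, rmorphM, rmorph_nat) /=.
rewrite -xE -yE -dE -cE /c !addn1 ![_ ^+ q.+1]exprS exprMn exprVn !EDq ENq zq z1q iq.
have -> : f B = (w + w^-1) / 2%:R.
  apply: (mulIf w0); apply: (mulIf E2); apply/eqP; rewrite -subr_eq0; apply/eqP.
  transitivity (- (w ^+ 2 - 2%:R * f B * w + 1)); first by field; rewrite E2 w0.
  by rewrite wE oppr0.
by field; rewrite oppr_eq0 w0 E2 E4 i0 z0 z10.
Qed.

Lemma mixed_secant_odd (A B : F) : odd q ->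
  exists a b x y, [/\ a ^+ q = a, b ^+ q = b,
    A = a * x ^+ 2 + b * y ^+ 2 &
    B = a * x ^+ (q + 1) + b * (-1 * y ^+ (q + 1))].
Proof.
move=> q_odd.
have F2 : 2%:R != 0 :> F.
  by move: q_odd; rewrite odd_card_finField -(fmorph_eq0 (in_alg F)) rmorph_nat.
have [->|A0] := eqVneq A 0.
  have [->|B0] := eqVneq B 0.
    exists 0, 0, 0, 0; rewrite !mul0r addr0; split=> //;
    by rewrite expr0n eqn0Ngt card_gt0.
  (* For A = 0 the choice b = -a, x = y leaves B = 2 a x^(q+1). *)
  have [] := @expq1_decomp (B / 2%:R); first by rewrite mulf_neq0 ?invr_eq0.
  move=> a [s [aq a0 s0 BE]]; exists a, (- a), s, s; rewrite frobN aq; split=> //; first by ring.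
  by rewrite -[B](divfK F2) BE; ring.
have [a [s [aq a0 s0 AE]]] := sqr_decomp A0.
(* Scaling x, y by s and both coefficients by a, where A = a s^2, reduces to A = 1. *)
suff [a' [b' [x [y [a'q b'q E1 E2]]]]] : exists a' b' x y,
    [/\ a' ^+ q = a', b' ^+ q = b',
    a' * x ^+ 2 + b' * y ^+ 2 = 1 &
    B / (a * s ^+ (q + 1)) = a' * x ^+ (q + 1) - b' * y ^+ (q + 1)].
  exists (a * a'), (a * b'), (s * x), (s * y); rewrite !exprMn aq a'q b'q; split=> //.
    by rewrite AE -[LHS]mulr1 -E1; ring.
  have as0 : a * s ^+ (q + 1) != 0 by rewrite mulf_neq0 ?expf_neq0.
  by rewrite -[B](divfK as0) E2; ring.
move: (B / _) => {A0 AE}B'.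
have [E [f [ED EQ]]] := closure_ext.
have [w wE] := closed_root_quad (- (2%:R * f B')) 1.
rewrite mulNr in wE.
have w0 : w != 0.
  by apply/eqP=> w0; move: wE; rewrite w0 expr0n mulr0 subr0 add0r => /eqP; rewrite oner_eq0.
pose Q := (q ^ (2 * n + 1))%N.
have Q0 : (0 < Q)%N by rewrite expn_gt0 card_gt0.
have wQE : (w ^+ Q) ^+ 2 - 2%:R * f B' * w ^+ Q + 1 = 0.
  have fQ x : f x ^+ Q = f x by rewrite -rmorphXn expf_card_ext.
  have := congr1 (fun x => x ^+ Q) wE.
  rewrite /= !ED expr1n expr0n eqn0Ngt Q0 mulr0n -(exprAC _ Q) => <-.
  by rewrite -mulNr -(rmorph_nat f) -rmorphM -rmorphN exprMn fQ rmorphN mulNr.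
(* [w] and [w ^+ Q] are roots of one quadratic whose roots have product 1, so [w ^+ Q] is w or
   1/w. *)
have : (w ^+ Q - w) * (w ^+ Q * w - 1) = 0.
  transitivity ((w ^+ Q) ^+ 2 * w - 2%:R * f B' * w ^+ Q * w + w
    - w ^+ Q * (w ^+ 2 - 2%:R * f B' * w + 1)); first by ring.
  rewrite wE mulr0 subr0 -[RHS](mul0r w) -wQE; ring.
move/eqP; rewrite mulf_eq0 !subr_eq0 => /orP[/eqP wQ|/eqP wQ]; last first.
  apply: (mixed_secant_unit_nonsplit q_odd ED EQ wE).
  by apply: (mulIf w0); rewrite wQ mulVf.
have [v vE] := EQ _ wQ; apply: (@mixed_secant_unit_split _ v) => //.
apply: (@fmorph_inj _ _ f).
by rewrite rmorph0 -wE vE !(rmorph1, rmorphD, rmorphN, rmorphM, rmorphXn, rmorph_nat).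
Qed.

(** The powers of g enumerate F*, which parametrises the points to be counted. *)
Lemma prim_root_ext :
  exists g : F, (q ^ (2 * n + 1) - 1).-primitive_root g.
Proof.
pose L : finFieldType := FinFieldExtType F.
have LQ : #|L| = (q ^ (2 * n + 1))%N := card_ext.
have L1 : (0 < #|L| - 1)%N by rewrite subn_gt0 finNzRing_gt1.
pose rs := rem (0 : L) (enum L).
suff /hasP[g _ gP] : has (#|L| - 1).-primitive_root rs by exists g; rewrite -LQ.
apply: has_prim_root => //.
- apply/allP=> x; rewrite mem_rem_uniq ?enum_uniq // !inE mem_enum andbT => x0.
  rewrite unity_rootE; apply/eqP/(mulIf x0).
  by rewrite -exprSr -addn1 subnK ?mul1r ?expf_card // ltnW ?finNzRing_gt1.
- by rewrite rem_uniq ?enum_uniq.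
- by rewrite size_rem ?mem_enum // -cardE subn1.
Qed.
End OddDegree.

(** * Linear algebra of points and lines *)

Section Lines.

Variables (K : fieldType) (V : vectType K).
Implicit Types u v w : V.

Lemma vline_eq u v : u != 0 -> u \in <[v]>%VS -> <[u]>%VS = <[v]>%VS.
Proof.
move=> u0 uv; apply/eqP; rewrite eqEdim -memvE uv !dim_vline u0.
by case: (v != 0).
Qed.

Lemma dim_add_vline u v : u != 0 -> v != 0 -> <[u]>%VS <> <[v]>%VS ->
  \dim (<[u]> + <[v]>) = 2%N.
Proof.
move=> u0 v0 uv; suff cap0 : (<[u]> :&: <[v]>)%VS = 0%VS.
  by rewrite dimv_disjoint_sum // !dim_vline u0 v0.
apply/eqP; rewrite -subv0; apply/subvP=> w; rewrite memv_cap memv0 => /andP[wu wv].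
by apply: contra_notT uv => w0; rewrite -(vline_eq w0 wu) (vline_eq w0 wv).
Qed.

Lemma collinear_comb u v w : u != 0 -> v != 0 -> <[u]>%VS <> <[v]>%VS ->
  collinear <[u]>%VS <[v]>%VS <[w]>%VS -> exists a b, w = a *: u + b *: v.
Proof.
move=> u0 v0 uv [l l2 [ul vl wl]].
have /eqP lE : (<[u]> + <[v]>)%VS == l.
  by rewrite eqEdim subv_add ul vl dim_add_vline // l2.
move: wl; rewrite -memvE -lE => /memv_addP[_ /vlineP[a ->] [_ /vlineP[b ->] ->]].
by exists a, b.
Qed.

Lemma comb_collinear u v a b : u != 0 -> v != 0 -> <[u]>%VS <> <[v]>%VS ->
  collinear <[u]>%VS <[v]>%VS <[a *: u + b *: v]>%VS.
Proof.
move=> u0 v0 uv; exists (<[u]> + <[v]>)%VS; first exact: dim_add_vline.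
by split; rewrite ?addvSl ?addvSr // -memvE memv_add ?memvZ ?memv_line.
Qed.

Lemma collinear_rot (U1 U2 U3 : {vspace V}) : collinear U1 U2 U3 -> collinear U2 U3 U1.
Proof. by case=> l l2 [? ? ?]; exists l. Qed.

Lemma collinear_swap (U1 U2 U3 : {vspace V}) : collinear U1 U2 U3 -> collinear U1 U3 U2.
Proof. by case=> l l2 [? ? ?]; exists l. Qed.

End Lines.

(** * The points of V_1 and V_alpha, and the cap property *)

Section Points.

Variables (K : finFieldType) (F : fieldExtType K) (n : nat).
Hypothesis dimF : \dim {:F} = (2 * n + 1)%N.
Let q := #|K|.

Definition vec (om x : F) : F * F := (x ^+ 2, om * x ^+ (q + 1)).

Lemma vec_neq0 (om x : F) : x != 0 -> vec om x != 0.
Proof.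
by move=> x0; apply/eqP=> -[/eqP]; rewrite sqrf_eq0 (negPf x0).
Qed.

Lemma scale_pair (k : K) (a b : F) : k *: (a, b) = (k%:A * a, k%:A * b).
Proof. by rewrite !mulr_algl. Qed.

(** Proportionality puts (x/y)^2 in K, hence also x/y because the degree is odd, and then the
    parameters agree. The equation x y^q = y x^q says that x/y is in K, with denominators
    cleared. *)
Lemma vec_eqP (om om' x y : F) : om != 0 -> x != 0 -> y != 0 ->
  <[vec om x]>%VS = <[vec om' y]>%VS <-> om = om' /\ x * y ^+ q = y * x ^+ q.
Proof.
move=> om0 x0 y0; split=> [E|[<- E]].
  have : vec om x \in <[vec om' y]>%VS by rewrite -E memv_line.
  case/vlineP=> k; rewrite scale_pair => -[E1 E2].
  have tE : (x / y) ^+ 2 = k%:A by rewrite expr_div_n E1 mulfK ?expf_neq0.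
  have tq : (x / y) ^+ q = x / y by apply: (sqr_fixed dimF); rewrite tE alg_fixed.
  have xE : x = (x / y) * y by rewrite divfK.
  have xqE : x ^+ q = (x / y) * y ^+ q by rewrite {1}xE exprMn tq.
  split; last by rewrite xqE; field.
  have z0 : k%:A * y ^+ (q + 1) != 0.
    by rewrite -tE mulf_neq0 ?expf_neq0 // mulf_neq0 ?invr_eq0.
  apply: (mulIf z0); rewrite [RHS]mulrCA -E2; congr (_ * _).
  by rewrite !expq1 xqE -tE; field.
have tq : (x / y) ^+ q = x / y.
  rewrite exprMn exprVn; apply: (mulIf y0); apply: (mulIf (expf_neq0 q y0)).
  by rewrite mulrAC divfK ?expf_neq0 // divfK // mulrC -E.
have [k kE] := fixed_alg tq; apply: vline_eq; first exact: vec_neq0.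
apply/vlineP; exists (k ^+ 2); rewrite scale_pair; congr (_, _).
  by rewrite -[_%:A]/(in_alg F _) rmorphXn /= -kE; field.
rewrite -[_%:A]/(in_alg F _) rmorphXn /= -kE !expq1.
have -> : x ^+ q = (x / y) * y ^+ q by rewrite -[in RHS]tq -exprMn divfK.
by field.
Qed.

(** Here beta is a ratio of parameters. In the first case the Gram determinant vanishes; in the
    second the trace argument excludes the relation. *)
Definition admissible (beta : F) : Prop :=
  beta ^+ 2 = 1 \/ [/\ ~~ odd q, beta ^+ q = beta & beta != 1].

(** Two of any three points of the union share a parameter, so up to order this form covers all
    triples. Dividing the second coordinates by om gives the relation with beta = om'/om. *)
Lemma not_collinear_vec (om om' x y z : F) :
    om != 0 -> x != 0 -> y != 0 -> z != 0 -> admissible (om' / om) ->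
    <[vec om x]>%VS <> <[vec om y]>%VS -> <[vec om x]>%VS <> <[vec om' z]>%VS ->
    <[vec om y]>%VS <> <[vec om' z]>%VS ->
  ~ collinear <[vec om x]>%VS <[vec om y]>%VS <[vec om' z]>%VS.
Proof.
move=> om0 x0 y0 z0 adm xy xz yz.
have [[vx vy] vz] := (vec_neq0 om x0, vec_neq0 om y0, vec_neq0 om' z0).
move=> /(collinear_comb vx vy xy)[a [b E]].
have a0 : a != 0.
  apply/eqP=> a0; apply: yz; apply/esym/vline_eq => //.
  by apply/vlineP; exists b; rewrite E a0 scale0r add0r.
have b0 : b != 0.
  apply/eqP=> b0; apply: xz; apply/esym/vline_eq => //.
  by apply/vlineP; exists a; rewrite E b0 scale0r addr0.
move: E; rewrite !scale_pair => -[E1 E2].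
have Aq (k : K) : (k%:A : F) ^+ q = k%:A by apply: alg_fixed.
have A0 (k : K) : k != 0 -> (k%:A : F) != 0 by rewrite -[_%:A]/(in_alg F k) fmorph_eq0.
have E3 : a%:A * x ^+ (q + 1) + b%:A * y ^+ (q + 1) = om' / om * z ^+ (q + 1).
  by apply: (mulfI om0); rewrite [RHS]mulrA [om * (_ / _)]mulrC divfK // E2; ring.
case: adm => [beta2|[q_even betaq beta1]]; last first.
  move: beta1.
  by rewrite (mixed_relation_even dimF q_even (Aq a) (Aq b) betaq z0 (esym E1) E3) eqxx.
apply: xy; apply/vec_eqP => //; split=> //.
exact: (mixed_relation_odd (Aq a) (Aq b) (A0 _ a0) (A0 _ b0) beta2 (esym E1) E3).
Qed.

Variable alpha : F.
Hypothesis alphaq : alpha ^+ q = alpha.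
Hypothesis alpha0 : alpha != 0.
Hypothesis alpha1 : alpha != 1.
Hypothesis alpha_odd : odd q -> alpha = -1.

Let S : set {vspace (F * F)%type} := Vset 1 `|` Vset alpha.

Lemma VsetP (U : {vspace (F * F)%type}) : S U <->
  exists om x, [/\ om = 1 \/ om = alpha, x != 0 & U = <[vec om x]>%VS].
Proof.
split=> [[[x x0 <-]|[x x0 <-]]|[om [x [[-> | ->] x0 ->]]]].
- by exists 1, x; split=> //; left.
- by exists alpha, x; split=> //; right.
- by left; exists x.
- by right; exists x.
Qed.

Lemma admissible_ratio (om om' : F) : om = 1 \/ om = alpha -> om' = 1 \/ om' = alpha ->
  admissible (om' / om).
Proof.
have [q_odd|q_even] := boolP (odd q).
  by rewrite alpha_odd // => -[] -> [] ->; left;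
    rewrite !(divr1, invrN1, mulrN1, opprK, sqrrN, expr1n).
case=> -> [] ->; rewrite ?divr1 ?divff //; try by left; rewrite expr1n.
- by right; split.
- right; rewrite div1r exprVn alphaq; split=> //.
  by rewrite -(inj_eq invr_inj) invrK invr1.
Qed.

Lemma cap_Vset : is_cap S.
Proof.
split=> [U /VsetP[om [x [_ x0 ->]]]|U1 U2 U3]; first
  by rewrite /= /is_point dim_vline vec_neq0.
move=> /VsetP[o1 [x [o1P x0 ->]]] /VsetP[o2 [y [o2P y0 ->]]] /VsetP[o3 [z [o3P z0 ->]]].
move=> xy xz yz col.
have om0 om : om = 1 \/ om = alpha -> om != 0 by case=> ->; rewrite ?oner_eq0.
have [o12|o12] := eqVneq o1 o2.
  move: (o1P) xy yz col; rewrite -o12 => ? xy yz; apply: not_collinear_vec => //; first exact: om0.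
  exact: admissible_ratio.
have [o13|o13] := eqVneq o1 o3.
  move: xz yz (collinear_swap col); rewrite -o13 => xz /nesym yz.
  by apply: not_collinear_vec => //; [exact: om0 | exact: admissible_ratio].
have o23 : o2 = o3.
  by case: o1P o2P o3P o12 o13 => -> [] -> [] ->; rewrite ?eqxx.
move: (nesym xz) (nesym xy) yz (collinear_rot col); rewrite -o23 => zx yx yz.
by apply: not_collinear_vec => //; [exact: om0 | exact: admissible_ratio].
Qed.

(** * Completeness *)

Lemma mixed_secant (A B : F) : exists (a b : K) (x y : F),
  (A, B) = a *: vec 1 x + b *: vec alpha y.
Proof.
have [a [b [x [y [aq bq AE BE]]]]] : exists a b x y, [/\ a ^+ q = a, b ^+ q = b,
    A = a * x ^+ 2 + b * y ^+ 2 &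
    B = a * x ^+ (q + 1) + b * (alpha * y ^+ (q + 1))].
  have [q_odd|q_even] := boolP (odd q); last exact: (mixed_secant_even dimF).
  by rewrite alpha_odd //; apply: (mixed_secant_odd dimF).
have [k kE] := fixed_alg aq; have [l lE] := fixed_alg bq.
by exists k, l, x, y; rewrite !scale_pair AE BE kE lE mul1r.
Qed.

Lemma complete_cap_Vset : is_complete_cap S.
Proof.
split; first exact: cap_Vset.
case=> T [Tpt Tcap] [ST]; apply=> U TU; apply: contrapT => SU.
have U1 : \dim U = 1%N := Tpt _ TU.
have v0 : vpick U != 0 by rewrite vpick0 -dimv_eq0 U1.
have UE : U = <[vpick U]>%VS.
  by apply/esym/eqP; rewrite eqEdim -memvE memv_pick dim_vline v0 U1.
move: (vpick U) v0 UE => v v0 UE.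
have [a [b [x [y vE]]]] := mixed_secant v.1 v.2.
rewrite -surjective_pairing in vE.
(* If x or y vanished, v would be a multiple of a single [vec] and U would already lie in S. *)
have inS om z c : om = 1 \/ om = alpha -> v = c *: vec om z -> False.
  move=> omP vz; have z0 : z != 0.
    by apply: contra_neq v0 => z0; rewrite vz scale_pair z0 !expr0n addn1 !mulr0.
  apply/SU/VsetP; exists om, z; split=> //; rewrite UE; apply: vline_eq => //.
  by apply/vlineP; exists c.
have x0 : x != 0.
  apply/eqP=> x0; apply: (inS alpha y b); first by right.
  by rewrite vE x0 scale_pair !expr0n addn1 !mulr0 add0r.
have y0 : y != 0.
  apply/eqP=> y0; apply: (inS 1 x a); first by left.
  by rewrite vE y0 [b *: _]scale_pair !expr0n addn1 !mulr0 addr0.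
have Sx : S <[vec 1 x]>%VS by apply/VsetP; exists 1, x; split=> //; left.
have Sy : S <[vec alpha y]>%VS by apply/VsetP; exists alpha, y; split=> //; right.
have xy : <[vec 1 x]>%VS <> <[vec alpha y]>%VS.
  by case/vec_eqP => //; [exact: oner_neq0 | move=> /esym/eqP; rewrite (negPf alpha1)].
have Uneq W : S W -> W <> U by move=> SW WU; apply: SU; rewrite -WU.
apply: (Tcap _ _ _ (ST _ Sx) (ST _ Sy) TU xy (Uneq _ Sx) (Uneq _ Sy)).
by rewrite UE vE; apply: comb_collinear => //; apply: vec_neq0.
Qed.

(** * Counting the points *)

Lemma card_Vset : (S #= `I_(2 * ((q ^ (2 * n + 1) - 1) %/ (q - 1))))%card.
Proof.
have [M QE] := @expn_odd_decomp q n (card_gt0 K).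
have q1 : (0 < q - 1)%N by rewrite subn_gt0 finNzRing_gt1.
rewrite QE addnK mulKn //.
have [g gP] := prim_root_ext dimF.
rewrite -/q QE addnK in gP.
have N0 : (0 < 1 + q * (q + 1) * M)%N by [].
move: (1 + q * (q + 1) * M)%N N0 gP QE => N N0 gP QE.
have xN1 (x : F) : x != 0 -> x ^+ ((q - 1) * N) = 1.
  by move=> x0; apply: (mulIf x0); rewrite mul1r -exprSr -addn1 -QE (expf_card_ext dimF).
have g0 : g != 0.
  apply/eqP=> g0; have /eqP := prim_expr_order gP.
  by rewrite g0 expr0n muln_eq0 !eqn0Ngt q1 N0 eq_sym oner_eq0.
have gX0 k : g ^+ k != 0 by rewrite expf_neq0.
(* As g has order (q - 1) N, g^N lies in K, so the point given by g^k depends only on k modulo N. *)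
have gNq : (g ^+ N) ^+ q = g ^+ N.
  by apply/eqP; rewrite fixedP // -exprM mulnC (prim_expr_order gP).
have gmod k : g ^+ k * (g ^+ (k %% N)) ^+ q = g ^+ (k %% N) * (g ^+ k) ^+ q.
  have -> : g ^+ k = (g ^+ N) ^+ (k %/ N) * g ^+ (k %% N).
    by rewrite -exprM mulnC -exprD -divn_eq.
  by move: (g ^+ (k %% N)) => r; rewrite !exprMn [_ ^+ _ ^+ q]exprAC gNq; ring.
(* Comparing exponents modulo (q - 1) N leaves N dividing j - i, which is less than N. *)
have ginj i j : (i < N)%N -> (j < N)%N ->
    g ^+ i * (g ^+ j) ^+ q = g ^+ j * (g ^+ i) ^+ q -> i = j.
  wlog ij : i j / (i <= j)%N => [wl|] iN jN E.
    by case/orP: (leq_total i j) => le; [apply: wl | apply/esym/wl].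
  move/eqP: E; rewrite -!exprM -!exprD (eq_prim_root_expr gP).
  rewrite eqn_mod_dvd; last by nia.
  have -> : (i + j * q - (j + i * q) = (q - 1) * (j - i))%N by nia.
  rewrite dvdn_pmul2l // => dv; apply/eqP; rewrite eqn_leq ij -subn_eq0 /=.
  by apply: contraTT dv; rewrite -lt0n => /gtnNdvd->; lia.
(* Indices below N enumerate V_1, those from N to 2N - 1 enumerate V_alpha. *)
pose om k : F := if (k < N)%N then 1 else alpha.
have omS k : om k = 1 \/ om k = alpha by rewrite /om; case: ifP; [left | right].
have om0 k : om k != 0 by case: (omS k) => ->; rewrite ?oner_neq0.
pose f k : {vspace (F * F)%type} := <[vec (om k) (g ^+ (k %% N))]>%VS.
have -> : S = f @` `I_(2 * N).
  apply/seteqP; split=> U.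
    case/VsetP=> w [x [wP x0 ->]].
    have [k ->] : exists k, x = g ^+ k.
      by have [k ->] := prim_rootP gP (xN1 x x0); exists k.
    have kN : (k %% N < N)%N by rewrite ltn_mod.
    have fE l : (l %% N = k %% N)%N -> om l = w -> f l = <[vec w (g ^+ k)]>%VS.
      by rewrite /f => -> <-; apply/vec_eqP.
    case: wP => wE.
      exists (k %% N)%N; first by rewrite /=; lia.
      by apply: fE; rewrite ?modn_mod // /om kN.
    exists (k %% N + N)%N; first by rewrite /=; lia.
    by apply: fE; rewrite ?modnDr ?modn_mod // /om ltnNge leq_addl.
  by case=> k _ <-; apply/VsetP; exists (om k), (g ^+ (k %% N)).
apply: inj_card_eq => k l; rewrite !inE /= => kN lN.
case/vec_eqP => // omE /ginj -/(_ (ltn_pmod _ N0) (ltn_pmod _ N0)) kl.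
have : (k < N)%N = (l < N)%N.
  move: omE; rewrite /om; do 2!case: ifP => //.
    by move=> _ _ /esym/eqP; rewrite (negPf alpha1).
  by move=> _ _ /eqP; rewrite (negPf alpha1).
case: (ltnP k N) => kN' /esym.
  by move=> lN'; rewrite !modn_small in kl.
move/negbT; rewrite -leqNgt => lN'; move: kl.
rewrite -{1}(subnK kN') -{1}(subnK lN') !modnDr !modn_small; lia.
Qed.

End Points.

Theorem theorem3p7 (q n : nat) (K : finFieldType) (F : fieldExtType K)
    (alpha : K)
    (Kq : #|K| = q) (q_gt2 : (2 < q)%N) (n_gt0 : (0 < n)%N)
    (dimF : \dim {:F} = (2 * n + 1)%N)
    (alpha_odd : odd q -> alpha = -1)
    (alpha_even : ~~ odd q -> alpha != 0 /\ alpha != 1) :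
  is_complete_cap (Vset (1 : F) `|` Vset (alpha%:A : F)) /\
  (Vset (1 : F) `|` Vset (alpha%:A : F)
     #= `I_(2 * ((q ^ (2 * n + 1) - 1) %/ (q - 1)))).
Proof.
subst q.
have [a0 a1] : alpha != 0 /\ alpha != 1.
  have [q_odd|/alpha_even //] := boolP (odd #|K|).
  rewrite alpha_odd // oppr_eq0 oner_neq0; split=> //.
  by rewrite eq_sym -addr_eq0 -odd_card_finField.
have A0 : (alpha%:A : F) != 0 by rewrite -[_%:A]/(in_alg F alpha) fmorph_eq0.
have A1 : (alpha%:A : F) != 1.
  by rewrite -[_%:A]/(in_alg F alpha) -(rmorph1 (in_alg F)) (inj_eq (@fmorph_inj _ _ _)).
have Aq : (alpha%:A : F) ^+ #|K| = alpha%:A by apply: alg_fixed.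
have Aodd : odd #|K| -> (alpha%:A : F) = -1 by move=> /alpha_odd ->; rewrite scaleN1r.
split; first exact: (complete_cap_Vset dimF Aq A0 A1 Aodd).
exact: (card_Vset dimF A0 A1).
Qed.
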